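(* Let $G$ be a countably infinite semigroup. An element $\alpha\in\{0,1\}^G$ is piecewise syndetic if and only if its orbit closure $\mathcal{O}(\alpha)$ possesses a nontrivial minimal subsystem.
   Context: $G$ is not assumed cancellative. For $A\subseteq G$ and $g\in G$ write $g^{-1}A=\{x\in G: gx\in A\}$, and $H^{-1}A=\bigcup_{h\in H}h^{-1}A$ for $H\subseteq G$. A set $A\subseteq G$ is (right) thick if for every finite $F\subseteq G$ there is $g\in G$ with $Fg\subseteq A$; it is (right) piecewise syndetic if $H^{-1}A$ is thick for some finite $H\subseteq G$. An element $\alpha\in\{0,1\}^G$ is called piecewise syndetic if $\alpha^{-1}(\{1\})\subseteq G$ is. Give $\{0,1\}^G$ the product topology and let $G$ act on it by continuous maps via $(g\alpha)(h)=\alpha(hg)$. The orbit closure of $\alpha$ is $\mathcal{O}(\alpha)=\overline{\{g\alpha:g\in G\}}$. A subsystem of a dynamical system is a nonempty closed set $C$ with $GC\subseteq C$; it is minimal if it contains no proper nonempty closed $G$-invariant subset. The trivial subsystem is $\{\mathbf{1}_\varnothing\}$, consisting of the zero function; a subsystem is nontrivial if it differs from it. *)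

(* Defs.v *)
From mathcomp Require Import all_boot.
From mathcomp Require Import all_classical topology.

Set Implicit Arguments.
Unset Strict Implicit.
Unset Printing Implicit Defensive.

Local Open Scope classical_set_scope.

Section PiecewiseSyndetic.
Variable G : semigroupType.
Implicit Types (g h : G) (A F H : set G).

Definition rtranslate F g : set G := [set (f * g)%g | f in F].

Definition lquotient g A : set G := [set x | A (g * x)%g].

Definition lquotient_set H A : set G := \bigcup_(h in H) lquotient h A.

Definition right_thick A : Prop :=
  forall F, finite_set F -> exists g, rtranslate F g `<=` A.

Definition right_piecewise_syndetic A : Prop :=
  exists2 H, finite_set H & right_thick (lquotient_set H A).

End PiecewiseSyndetic.

Section Systems.
Variables (G : Type) (X : topologicalType) (act : G -> X -> X).
Implicit Types (C D Y : set X) (x : X).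

Definition orbit_closure x : set X := closure [set act g x | g in [set: G]].

(* Closedness is taken in X; for closed Y, such as an orbit closure, this
   agrees with closedness in the subspace Y. *)
Definition subsystem Y C : Prop :=
  [/\ C !=set0, closed C, C `<=` Y & forall g x, C x -> C (act g x)].

Definition minimal_subsystem Y C : Prop :=
  subsystem Y C /\ forall D, subsystem C D -> ~ D `<` C.

End Systems.

(* {0,1}^G with the product topology, 0 and 1 being false and true. *)
Notation config G := {ptws G -> bool}.

Section Shift.
Variable G : semigroupType.
Implicit Types (g h : G) (a : config G).

Definition shift g a : config G := fun h => a (h * g)%g.

Lemma shiftM g h a : shift g (shift h a) = shift (g * h)%g a.
Proof. by apply/funext => x; rewrite /shift mulgA. Qed.

Lemma shift_continuous g : continuous (shift g).
Proof.
move=> a; apply/cvg_sup => h; apply/cvg_image.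
  by apply/seteqP; split=> // b _; exists (cst b).
have pc := @proj_continuous G (fun=> bool) (h * g)%g a.
move=> B /= nB; exists ((fun b : config G => b h) @^-1` B); first exact: pc.
by apply/image_preimage/seteqP; split=> // b _; exists (cst b).
Qed.

Definition ps_config a : Prop :=
  right_piecewise_syndetic (a @^-1` [set true]).

End Shift.

Prenex Implicits shift.

Definition trivial_subsystem (G : semigroupType) : set (config G) :=
  [set (fun _ => false)].
Arguments trivial_subsystem : clear implicits.

(* Main.v *)
Require Import Defs.
From mathcomp Require Import all_boot.
From mathcomp Require Import all_classical topology.

(** For a finite set [H], call a configuration [H]-returning when every right
    translate [H f] contains a point where it takes the value 1.  These
    configurations form a closed shift-invariant set [returns H] that misses the
    zero configuration, and both sides of the equivalence say that some such set
    meets the orbit closure of [alpha].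

    Piecewise syndeticity of [alpha] with witness [H] says that for each finite
    [F] some translate of [alpha] has a 1 in [H f] for all [f] in [F].  By
    compactness of the orbit closure there is a limit of translates that does so
    for all [f] at once ([ps_returns]).  Conversely, when [b] is in the orbit
    closure and is [H]-returning, a translate of [alpha] that agrees with [b] on
    the finite set [H F] gives back the thickness condition for [F]
    ([returns_ps]).

    If [returns H] meets the orbit closure, the intersection is a subsystem, and
    by Zorn's lemma it contains a minimal one ([minimal_subsystem_exists]), which
    is nontrivial since zero is not [H]-returning.  Conversely, a nontrivial
    minimal subsystem [M] does not contain zero.  So each point of [M] takes the
    value 1 somewhere, and by compactness a finite [H] serves for all of [M].
    Applying this to the translates of a point of [M], which stay in [M], shows
    that the point is [H]-returning ([zero_free_returns]). *)

Local Open Scope classical_set_scope.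

(** Cantor's intersection theorem for a downward directed family: its sets
    generate a proper filter, and a cluster point of that filter lies in each of
    them because they are closed. *)
Lemma compact_directed_bigcap (X : topologicalType) (I : Type) (K : set X)
    (D : set I) (f : I -> set X) :
  compact K -> D !=set0 ->
  (forall i, D i -> [/\ f i !=set0, closed (f i) & f i `<=` K]) ->
  (forall i j, D i -> D j -> exists2 k, D k & f k `<=` f i `&` f j) ->
  \bigcap_(i in D) f i !=set0.
Proof.
move=> cK [i0 Di0] fP fdir.
have FF : ProperFilter (filter_from D f).
  apply: filter_from_proper => [|i /fP[]//].
  by apply: filter_from_filter => //; exists i0.
have [|x [_ clx]] := cK _ FF; first by exists i0 => //; case: (fP _ Di0).
exists x => i Di; have [_ /closure_id cfi _] := fP i Di.
by move: clx; rewrite clusterE => /(_ (f i)); rewrite -cfi; apply; exists i.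
Qed.

Lemma compact_finite_bigcap (X : topologicalType) (I : choiceType) (K : set X)
    (f : I -> set X) :
  compact K -> closed K -> (forall i, closed (f i)) ->
  (forall F, finite_set F -> K `&` \bigcap_(i in F) f i !=set0) ->
  K `&` \bigcap_i f i !=set0.
Proof.
move=> cK clK clf finf.
have [|F fF|E F fE fF|x Kx] := @compact_directed_bigcap X (set I) K
    [set F | finite_set F] (fun F => K `&` \bigcap_(i in F) f i) cK.
- by exists set0; exact: finite_set0.
- split; [exact: finf| |by move=> x []].
  by apply: closedI => //; exact: closed_bigI.
- exists (E `|` F); first by rewrite /= finite_setU.
  by move=> x [Kx EFx]; split; split=> // i Ei; apply: EFx; [left|right].
- exists x; split=> [|i _]; first by have [] := Kx set0 (finite_set0 _).
  by have [_] := Kx [set i] (finite_set1 i); apply.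
Qed.

(** Zorn's lemma for the reverse inclusion on subsystems of [C].  It is applied
    to the sets removed from [C], so that a descending chain of subsystems
    becomes a chain of sets with their union as upper bound. *)
Lemma minimal_subsystem_exists {G : Type} {X : topologicalType}
    (act : G -> X -> X) (Y C : set X) :
  compact Y -> subsystem act Y C ->
  exists2 M, minimal_subsystem act Y M & M `<=` C.
Proof.
move=> cY [C0 cC CY Cinv].
have [|U [[N0 cN NY Ninv] maxU]] :=
  @Zorn_bigcup X [set U | subsystem act C (C `\` U)].
  move=> F FP Ftot.
  have [->|/set0P F0] := eqVneq F set0.
    by rewrite /= bigcup_set0 setD0; split.
  rewrite /= (_ : C `\` \bigcup_(U in F) U = \bigcap_(U in F) (C `\` U));
    last first.
    have [U0 FU0] := F0.
    apply/seteqP; split=> [x [Cx nx] U FU|x Fx].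
      by split=> // Ux; apply: nx; exists U.
    by split=> [|[U FU Ux]]; [case: (Fx _ FU0)|case: (Fx _ FU)].
  split.
  - apply: (compact_directed_bigcap _ _ Y) => // [U /FP[? ? UC _]|U V FU FV].
      by split=> //; exact: subset_trans UC CY.
    have [UV|VU] := Ftot _ _ FU FV.
      by exists V => // x [Cx Vx]; split; split=> // /UV.
    by exists U => // x [Cx Ux]; split; split=> // /VU.
  - by apply: closed_bigI => U /FP[].
  - by have [U0 FU0] := F0 => x /(_ _ FU0)[].
  - by move=> g x Fx U FU; have [_ _ _] := FP _ FU; apply; exact: Fx.
exists (C `\` U) => //; split.
  by split=> // x [/CY].
move=> D [D0 cD DC Dinv] [DM nMD]; apply: (maxU (~` D)).
  split=> [x Ux Dx|DU]; first by have [] := DM _ Dx.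
  by apply: nMD => x [Cx nUx]; apply: contrapT => /DU.
rewrite /= setDE setCK (_ : C `&` D = D); last first.
  by apply/setIidPr => x /DM[].
by split=> // x /DM[].
Qed.

Section Shift.
Variable G : semigroupType.
Implicit Types (a b : config G) (F H : set G).

Lemma compact_config (Y : set (config G)) : closed Y -> compact Y.
Proof.
move=> cY.
have cT := @tychonoff G (fun=> bool) (fun=> setT) (fun=> bool_compact).
by apply: (subclosed_compact cY cT) => b _ h.
Qed.

Lemma closed_eval h (c : bool) : closed [set b : config G | b h = c].
Proof.
apply: (@preimage_closed _ _ (fun b : config G => b h) [set c]) => [b _|].
  exact: (@proj_continuous G (fun=> bool) h b).
exact: discrete_closed.
Qed.

Lemma nbhs_eq_on a F : finite_set F ->
  nbhs a [set b : config G | forall f, F f -> b f = a f].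
Proof.
case/finite_fsetP=> D ->.
have := @filter_bigI _ _ D (fun f => [set b : config G | b f = a f]) (nbhs a).
by apply=> f _; exact: (@proj_continuous G (fun=> bool) f a _ (discrete_set1 _)).
Qed.

Lemma orbit_closure_subsystem a : [set: G] !=set0 ->
  subsystem shift (orbit_closure shift a) (orbit_closure shift a).
Proof.
move=> [g0 _]; split=> //.
- by exists (shift g0 a); apply: subset_closure; exists g0.
- exact: closed_closure.
move=> g b cb B nB; have [_ [[k _ <-] Bk]] := cb _ (shift_continuous nB).
by exists (shift (g * k)%g a); split; [exists (g * k)%g|rewrite -shiftM].
Qed.

(** In dynamical terms: every translate [shift f b] lies in the open set of
    configurations that are not identically 0 on [H]. *)
Definition returns H : set (config G) :=
  [set b | forall f, exists2 h, H h & b (h * f)%g = true].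

Lemma returns_shift H b g : returns H b -> returns H (shift g b).
Proof.
move=> rb f; have [h Hh] := rb (f * g)%g.
by exists h; rewrite // /shift -mulgA.
Qed.

Lemma returnsE H : returns H =
  \bigcap_f \bigcup_(h in H) [set b : config G | b (h * f)%g = true].
Proof.
by apply/seteqP; split=> [b rb f _|b rb f]; [exact: rb|exact: (rb f I)].
Qed.

(** A union over [h] in [H] of closed conditions stays closed only because [H]
    is finite. *)
Lemma closed_returns_at H f : finite_set H ->
  closed (\bigcup_(h in H) [set b : config G | b (h * f)%g = true]).
Proof. by move=> fH; apply: closed_bigcup => // h _; exact: closed_eval. Qed.

Lemma closed_returns H : finite_set H -> closed (returns H).
Proof.
by move=> fH; rewrite returnsE; apply: closed_bigI => f _; exact: closed_returns_at.
Qed.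

(** Thickness gives, for each finite [F], a translate of [a] with a 1 in [H f]
    for all [f] in [F]; compactness passes to all [f] simultaneously. *)
Lemma ps_returns a : [set: G] !=set0 -> ps_config a ->
  exists2 H, finite_set H & orbit_closure shift a `&` returns H !=set0.
Proof.
move=> G0 [H fH thick]; exists H => //.
have [_ cO _ _] := orbit_closure_subsystem a G0.
rewrite returnsE; apply: compact_finite_bigcap => //.
- exact: compact_config.
- by move=> f; exact: closed_returns_at.
move=> F fF; have [g Fg] := thick F fF; exists (shift g a); split.
  by apply: subset_closure; exists g.
move=> f Ff; have [|h Hh /= hfg] := Fg (f * g)%g; first by exists f.
by exists h => //; rewrite /= /shift -mulgA.
Qed.

(** Thickness for [F] only tests a translate of [a] on the finite set [H F],
    where some translate agrees with the limit point [b]. *)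
Lemma returns_ps a H b :
  finite_set H -> orbit_closure shift a b -> returns H b -> ps_config a.
Proof.
move=> fH Ob rb; exists H => // F fF.
have fHF : finite_set [set (h * f)%g | h in H & f in F] by exact: finite_image2.
have [_ [[g _ <-] eqb]] := Ob _ (nbhs_eq_on b _ fHF).
exists g => _ [f Ff <-]; have [h Hh bhf] := rb f.
exists h => //; rewrite /lquotient /= mulgA -[RHS]bhf -eqb //.
by exists h => //; exists f.
Qed.

(** If no finite [H] worked, each finite [H] would admit a point of [M] that is
    0 on [H], namely a translate of a point failing to be [H]-returning; by
    compactness zero would be in [M]. *)
Lemma zero_free_returns (Y M : set (config G)) :
  subsystem shift Y M -> ~ M (fun=> false) ->
  exists2 H, finite_set H & M `<=` returns H.
Proof.
move=> [M0 cM _ Minv] nM0; apply: contrapT => nH; apply: nM0.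
have [|//|h|H fH|b [Mb b0]] := @compact_finite_bigcap _ G M
    (fun h => [set b : config G | b h = false]).
- exact: compact_config.
- exact: closed_eval.
- apply: contrapT => M0H; apply: nH; exists H => // b Mb f.
  apply: contrapT => nb; apply: M0H; exists (shift f b).
  split; first exact: Minv.
  by move=> h Hh; apply/negP => bhf; apply: nb; exists h.
- rewrite (_ : (fun=> false) = b) //.
  by apply/funext => h; apply/esym; exact: b0.
Qed.

Lemma nontrivial_minimal_zero_free (Y M : set (config G)) :
  minimal_subsystem shift Y M -> M <> trivial_subsystem G ->
  ~ M (fun=> false).
Proof.
move=> [_ minM] Mnz M0.
apply: (minM (trivial_subsystem G)).
  split=> [||_ ->//|g _ ->//]; first by exists (fun=> false).
  apply: accessible_closed_set1; apply: hausdorff_accessible.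
  by apply: hausdorff_product => x; exact: discrete_hausdorff.
by split=> [_ ->//|Msub]; apply: Mnz; apply/seteqP; split=> // _ ->.
Qed.

End Shift.

Theorem theorem45 (G : semigroupType)
    (cntG : countable [set: G]) (infG : infinite_set [set: G])
    (alpha : config G) :
  ps_config alpha <->
  exists M : set (config G),
    minimal_subsystem shift (orbit_closure shift alpha) M /\
    M <> trivial_subsystem G.
Proof.
have G0 := infinite_setN0 infG.
have [_ cO _ Oinv] := orbit_closure_subsystem _ alpha G0.
split=> [/(ps_returns _ _ G0)[H fH OH]|[M [minM Mnz]]].
  have [|M minM MO] := minimal_subsystem_exists shift
      (orbit_closure shift alpha) (orbit_closure shift alpha `&` returns _ H)
      (compact_config _ _ cO).
    split=> //; first by apply: closedI => //; exact: closed_returns.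
    by move=> g b [Ob rb]; split; [exact: Oinv|exact: returns_shift].
  exists M; split=> // Mz; have [g _] := G0.
  (* A trivial M would make zero an H-returning configuration. *)
  have [_ /(_ g)[h]//] :
    (orbit_closure shift alpha `&` returns G H) (fun=> false).
  by apply: MO; rewrite Mz.
have nM := nontrivial_minimal_zero_free _ _ _ minM Mnz.
have [subM _] := minM; have [H fH MH] := zero_free_returns _ _ _ subM nM.
have [[b Mb] _ MO _] := subM.
by apply: (returns_ps _ _ H b) => //; [exact: MO|exact: MH].
Qed.
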